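(* Let $(X,f)$ be a compact dynamical system and let $x,y\in X$ be such that $x\,\mathcal{C}\,y$. Let $\{S_n\}_{n=1}^\infty$ be a complete sequence of order-compatible nested chains from $x$ to $y$, and set $S=\bigcup_n\widehat{S_n}$ and $S'=S\setminus\{x,y\}$. Then, for every chain component $K\subseteq X$, the set $K\cap S'$ is convex in the ordered limit set $(S',\le_\infty)$.
   Context: A compact dynamical system $(X,f)$ is a compact metric space $(X,d)$ with a continuous map $f:X\to X$. For $\varepsilon>0$, an $\varepsilon$-chain from $x$ to $y$ is a finite indexed sequence $C:x_0,\dots,x_m$ in $X$ with $m\ge1$, $x_0=x$, $x_m=y$, $d(f(x_i),x_{i+1})<\varepsilon$ for $0\le i<m$; its support is $\widehat C=\{x_0,\dots,x_m\}$. $x\,\mathcal{C}\,y$ means that for every $\varepsilon>0$ there is an $\varepsilon$-chain from $x$ to $y$. Chain components are the equivalence classes of the relation ''$x\,\mathcal{C}\,y$ and $y\,\mathcal{C}\,x$'' on the set of points $x$ with $x\,\mathcal{C}\,x$. A chain is acyclic if $x_1,\dots,x_{m-1}$ are pairwise distinct and none equals $x_0$ or $x_m$ ($x_0=x_m$ is allowed). An acyclic chain $S_n$ induces on $\widehat{S_n}$ the relation $\le_n$: $u\le_n v$ iff $u=x_i,v=x_j$ for some $i\le j$ (a linear order on $\widehat{S_n}\setminus\{x,y\}$). A complete sequence of order-compatible nested chains from $x$ to $y$ is a sequence $\{S_n\}$ where $S_n$ is an acyclic $\varepsilon_n$-chain from $x$ to $y$ for some positive reals $\varepsilon_n$ converging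 monotonically to $0$, $\widehat{S_n}\subseteq\widehat{S_{n+1}}$, and $u\le_n v$ implies $u\le_{n+1}v$ for $u,v\in\widehat{S_n}$. The limit order on $S\setminus\{x,y\}$ is: $u\le_\infty v$ iff $u\le_n v$ for every $n$ with $u,v\in\widehat{S_n}$. A subset $M$ of a linearly ordered set is convex if $a,b\in M$ and $a\preceq c\preceq b$ imply $c\in M$. *)

(* Defs.v *)
From mathcomp Require Import all_boot all_order all_algebra.
From mathcomp Require Import boolp classical_sets reals topology sequences.

Set Implicit Arguments.
Unset Strict Implicit.
Unset Printing Implicit Defensive.

Import Order.TTheory GRing.Theory Num.Theory.
Import numFieldTopology.Exports.
Local Open Scope classical_set_scope.
Local Open Scope ring_scope.

(* A chain x_0, ..., x_m is the list C = [:: x_0; ...; x_m], so m >= 1 reads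
   1 < size C. The default value given to head, last or nth is never reached. *)
Definition is_chain (R : realType) (X : metricType R) (f : X -> X) (eps : R)
    (x y : X) (C : seq X) : Prop :=
  [/\ (1 < size C)%N, head x C = x, last x C = y &
      sorted (fun u v => mdist (f u) v < eps) C].

Definition chain_rel (R : realType) (X : metricType R) (f : X -> X)
    (x y : X) : Prop :=
  forall eps : R, 0 < eps -> exists C : seq X, is_chain f eps x y C.

Definition is_chain_component (R : realType) (X : metricType R) (f : X -> X)
    (K : set X) : Prop :=
  exists2 z, chain_rel f z z &
    K = [set w | [/\ chain_rel f w w, chain_rel f z w & chain_rel f w z]].

Definition chain_support (T : eqType) (C : seq T) : set T := [set u | u \in C].

(* x_1, ..., x_{m-1} *)
Definition interior_points (T : Type) (C : seq T) : seq T :=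
  behead (take (size C).-1 C).

Definition is_acyclic_chain (R : realType) (X : metricType R) (f : X -> X)
    (eps : R) (x y : X) (C : seq X) : Prop :=
  [/\ is_chain f eps x y C, uniq (interior_points C),
      x \notin interior_points C & y \notin interior_points C].

Definition chain_le (T : Type) (C : seq T) (u v : T) : Prop :=
  exists i j : nat,
    [/\ (i <= j)%N, (j < size C)%N, nth u C i = u & nth u C j = v].

(* S n is the (n+1)-st chain of the sequence. *)
Definition complete_nested_chains (R : realType) (X : metricType R)
    (f : X -> X) (x y : X) (S : nat -> seq X) : Prop :=
  exists eps : nat -> R,
    [/\ forall n, 0 < eps n,
        nonincreasing_seq eps,
        eps @ \oo --> (0 : R) &
        forall n,
          [/\ is_acyclic_chain f (eps n) x y (S n),
              chain_support (S n) `<=` chain_support (S n.+1) &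
              forall u v, chain_support (S n) u -> chain_support (S n) v ->
                chain_le (S n) u v -> chain_le (S n.+1) u v]].

Definition limit_set (T : eqType) (S : nat -> seq T) (x y : T) : set T :=
  (\bigcup_n chain_support (S n)) `\` [set x; y].

(* Only meant for u and v in limit_set S x y. *)
Definition limit_le (T : eqType) (S : nat -> seq T) (u v : T) : Prop :=
  forall n, chain_support (S n) u -> chain_support (S n) v -> chain_le (S n) u v.

(* M is a convex subset of A ordered by le. *)
Definition convex_in (T : Type) (le : T -> T -> Prop) (A M : set T) : Prop :=
  M `<=` A /\
  forall a b c, M a -> M b -> A c -> le a c -> le c b -> M c.

(* Main.v *)
Require Import Defs.
From mathcomp Require Import all_boot all_order all_algebra.
From mathcomp Require Import boolp classical_sets reals topology sequences.
From mathcomp Require Import normedtype zify.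

(* Consecutive terms of S_n cut out a subchain, so u <_n v yields an eps_n-chain
   from u to v; letting n grow, u <_oo v implies u C v. Hence a point c strictly
   between two points a, b of K satisfies z C a C c C b C z for any z in K. *)

Local Open Scope classical_set_scope.

Import Order.TTheory.

(** The junction point [y] ends [C] and begins [D]; [behead] keeps a single copy, so the first step
    of [D] becomes the step leaving the last term of [C]. *)
Lemma is_chain_cat {R : realType} {X : metricType R} {f : X -> X} {eps : R}
    {x y z : X} {C D : seq X} :
  is_chain f eps x y C -> is_chain f eps y z D ->
  is_chain f eps x z (C ++ behead D).
Proof.
case: C => [|x0 C] [] //= szC -> lastC pathC.
case: D => [|y0 D] [] //= szD -> lastD pathD.
split => //=; first by rewrite size_cat ltnS ltn_addr.
  by rewrite last_cat lastC.
by rewrite cat_path pathC lastC.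
Qed.

Lemma chain_rel_trans {R : realType} {X : metricType R} {f : X -> X}
    {x y z : X} :
  chain_rel f x y -> chain_rel f y z -> chain_rel f x z.
Proof.
move=> xy yz e e0; have [C xCy] := xy e e0; have [D yDz] := yz e e0.
by exists (C ++ behead D); apply: is_chain_cat yDz.
Qed.

Lemma is_chain_le {R : realType} {X : metricType R} {f : X -> X}
    {eps eps' : R} {x y : X} {C : seq X} :
  (eps <= eps')%R -> is_chain f eps x y C -> is_chain f eps' x y C.
Proof.
move=> le_eps [szC hC lC sC]; split=> //.
by apply: sub_sorted sC => u v /lt_le_trans; apply.
Qed.

(** The witness is the slice x_i, ..., x_j. Since [u <> v] forces i < j, it has at least two terms,
    as a chain must. *)
Lemma is_chain_infix {R : realType} {X : metricType R} {f : X -> X} {eps : R}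
    {x y u v : X} {C : seq X} :
  is_chain f eps x y C -> chain_le C u v -> u <> v ->
  exists D, is_chain f eps u v D.
Proof.
move=> [_ _ _ sC] [i [j [le_ij ltj Cu Cv]]] neq_uv.
have lt_ij : (i < j)%N.
  rewrite ltn_neqAle le_ij andbT; apply/eqP => eq_ij; apply: neq_uv.
  (* The two lookups carry different defaults, [u] and [v]; they agree because [j] is within
     bounds. *)
  by rewrite -Cu -Cv eq_ij; apply: set_nth_default.
have szD : size (take (j - i).+1 (drop i C)) = (j - i).+1.
  by rewrite size_take size_drop; case: ltnP => //; lia.
exists (take (j - i).+1 (drop i C)); split.
- by rewrite szD ltnS subn_gt0.
- by rewrite -nth0 nth_take // nth_drop addn0.
- by rewrite -nth_last szD /= nth_take // nth_drop subnKC.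
- by apply: take_sorted; apply: drop_sorted.
Qed.

Lemma limit_le_chain_rel {R : realType} {X : metricType R} {f : X -> X}
    {x y : X} {S : nat -> seq X} {u v : X} :
  complete_nested_chains f x y S ->
  limit_set S x y u -> limit_set S x y v -> limit_le S u v -> u <> v ->
  chain_rel f u v.
Proof.
move=> [eps [_ _ eps_cvg chainS]] [[m _ Su] _] [[n _ Sv] _] le_uv neq_uv e e0.
(* Nestedness, iterated: once [u] and [v] have both appeared, they stay in every later support, so
   [le_uv] applies at all large indices. *)
have subS k l : (k <= l)%N -> chain_support (S k) `<=` chain_support (S l).
  elim: l => [|l IHl]; first by rewrite leqn0 => /eqP ->.
  rewrite leq_eqVlt => /predU1P[-> //|/IHl subkl].
  by have [_ subl _] := chainS l; apply: subset_trans subl.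
have [N _ epsN] := cvgr_lt _ eps_cvg _ e0.
(* At this index the chain contains both points and its tolerance is already below [e]. *)
pose k := maxn N (maxn m n).
have [[chainSk _ _ _] _ _] := chainS k.
have le_uvk : chain_le (S k) u v.
  apply: le_uv.
    by apply: (subS m) Su; rewrite /k !leq_max leqnn orbT.
  by apply: (subS n) Sv; rewrite /k !leq_max leqnn !orbT.
have [D chainD] := is_chain_infix chainSk le_uvk neq_uv.
exists D; apply: is_chain_le chainD; apply/ltW/epsN.
exact: leq_maxl.
Qed.

Theorem theorem6p2 (R : realType) (X : metricType R) (f : X -> X)
    (hX : compact [set: X]) (hf : continuous f)
    (x y : X) (hxy : chain_rel f x y)
    (S : nat -> seq X) (hS : complete_nested_chains f x y S)
    (K : set X) (hK : is_chain_component f K) :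
  convex_in (limit_le S) (limit_set S x y) (K `&` limit_set S x y).
Proof.
split; first exact: subIsetr.
move=> a b c [Ka Sa] [Kb Sb] Sc le_ac le_cb; split=> //.
(* If [c] equals [a] or [b], it lies in [K] at once; otherwise both order relations are strict and
   give chains. *)
have [<- //|/eqP neq_ac] := eqVneq a c.
have [-> //|/eqP neq_cb] := eqVneq c b.
have ac := limit_le_chain_rel hS Sa Sc le_ac neq_ac.
have cb := limit_le_chain_rel hS Sc Sb le_cb neq_cb.
case: hK Ka Kb => z _ -> [_ za _] [_ _ bz].
have zc := chain_rel_trans za ac; have cz := chain_rel_trans cb bz.
(* Chain recurrence of [c] comes from the loop through [z]. *)
by split=> //; apply: chain_rel_trans zc.
Qed.
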